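(* If there exist universal cycles on the $4$-subsets of $[18]$ and on the $4$-subsets of $[26]$, then for every integer $n\ge 18$ with $n\equiv 2 \pmod 8$ there exists a universal cycle on the $4$-subsets of $[n]$.
   Context: $[n]=\{0,1,\ldots,n-1\}$. A cycle is a finite nonempty string $C$ of symbols, of length $|C|$; for any integer $x$, $C_x$ denotes the $(x+1)$-th symbol of $C$, with the index read modulo $|C|$ (so the first symbol is $C_0$). A universal cycle on the $k$-subsets of a finite set $\mathcal{A}$ is a cycle $C$ such that, for each $0\le x\le |C|-1$, the $k$ cyclically consecutive symbols $C_x,C_{x+1},\ldots,C_{x+k-1}$ are pairwise distinct elements of $\mathcal{A}$, and every $k$-element subset of $\mathcal{A}$ equals $\{C_x,\ldots,C_{x+k-1}\}$ for exactly one $x\in\{0,\ldots,|C|-1\}$. *)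

(* Defs.v *)
From mathcomp Require Import all_boot.

Set Implicit Arguments.
Unset Strict Implicit.
Unset Printing Implicit Defensive.

(* A cycle over T is a nonempty string, represented by its length m.+1 and a  *)
(* C : m.+1.-tuple T.                                                         *)

(* C_x, with the index x read modulo the length of C; inord does not truncate *)
(* since x %% m.+1 < m.+1.                                                    *)
Definition cycle_symbol (T : Type) (m : nat) (C : m.+1.-tuple T) (x : nat) : T :=
  tnth C (inord (x %% m.+1)).

(* C_x, C_(x+1), ..., C_(x+k-1); when k > m.+1 it wraps around.               *)
Definition window (T : Type) (m : nat) (C : m.+1.-tuple T) (k x : nat) : seq T :=
  mkseq (fun i => cycle_symbol C (x + i)) k.

Definition universal_cycle (T : finType) (k : nat) (A : {set T})
    (m : nat) (C : m.+1.-tuple T) : Prop :=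
  (forall x : 'I_m.+1, uniq (window C k x) /\ {subset window C k x <= A}) /\
  (forall S : {set T}, S \subset A -> #|S| = k ->
     exists! x : 'I_m.+1, S = [set:: window C k x]).

Definition has_universal_cycle (T : finType) (k : nat) (A : {set T}) : Prop :=
  exists (m : nat) (C : m.+1.-tuple T), universal_cycle k A C.

(* Main.v *)
Require Import Defs.
From mathcomp Require Import all_boot.
From mathcomp Require Import zify.

Set Implicit Arguments.
Unset Strict Implicit.
Unset Printing Implicit Defensive.

(** The construction produces a universal cycle on the 4-subsets of [n] for every
    n = 8m + 2 with m > 0.

    It rests on one remark: if two closed words u and v of length at least 4 begin
    with the same three symbols, the windows of length 4 of the closed word uv are
    those of u and those of v ([windows_splice]). Hence it suffices to find a family
    of closed words whose windows are all the 4-subsets, each once, and which is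
    connected when two words sharing three consecutive symbols are joined
    ([joined_rank]).

    The points 0, ..., 8m+1 are cut into the 4m + 1 pairs (2i, 2i+1); pair 0 is
    kept apart and the others form m blocks of four consecutive pairs. The support
    of a 4-subset is the set of two, three or four pairs that it meets. A 4-subset
    has an [owner], a set of pairs containing its support, and the 4-subsets with
    a given owner are listed by copies of one of four fixed templates:
    - four pairs that do not all lie in pair 0 and a single block: the 16 transversals of
      pairs (a,a'), (b,b'), (c,c'), (d,d') are the windows of the closed words
      a b c d a' b' c' d' and a b' c d' a' b c' d;
    - three pairs other than pair 0, not all in one block: the 12 sets made of one
      of the pairs and a point of each of the others are the windows of
      a b a' c' b' c and a b' a' c b c', since a window of a closed word on six
      points is the complement of two adjacent letters, and these two hexagons
      partition the edges of the octahedron;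
    - pair 0 and a block: a universal cycle on the 4-subsets of ten points;
    - pair 0 and two blocks: a closed word of length 208 whose windows have for
      support one pair of each block, with or without pair 0.
    The last template carries the difficulty. A point belongs to four windows for
    each of its occurrences in a closed word, so a union of two pairs can only be
    listed together with enough other sets for all degrees to be multiples of 4;
    two blocks and pair 0 give enough room for that.

    That each template lists the right sets is decided by evaluation
    ([template_windows]); monotone relabelling carries this to all clusters, and
    the clusters partition the 4-subsets because the owner can be read off the
    support ([owner_owned], [all_windows]). Connectedness is [placements_joined].
    The last step turns a closed word of natural numbers into a universal cycle
    ([universal_cycle_of_seq]). *)

(** * Gluing closed words *)

Section Windows.
Variables (T : eqType).
Implicit Types (c d u v : seq T) (k : nat).

Definition windows k c := [seq take k (rot i c) | i <- iota 0 (size c)].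

Lemma size_windows k c : size (windows k c) = size c.
Proof. by rewrite size_map size_iota. Qed.

Lemma windows_take j k c : j <= k -> windows j c = map (take j) (windows k c).
Proof.
move=> le_jk; rewrite -map_comp; apply: eq_map => i /=.
by rewrite take_takel.
Qed.

Lemma windowsP k c w :
  reflect (exists2 i, i < size c & w = take k (rot i c)) (w \in windows k c).
Proof.
apply: (iffP mapP) => [] [i].
  by rewrite mem_iota => /andP[_ lt_i] ->; exists i.
by move=> lt_i ->; exists i; rewrite ?mem_iota.
Qed.

(** Both halves have the same form, so exchanging u and v only permutes the
    windows. *)
Lemma windows_cat k u v :
  windows k (u ++ v) = [seq take k (rot i (u ++ v)) | i <- iota 0 (size u)]
                    ++ [seq take k (rot i (v ++ u)) | i <- iota 0 (size v)].
Proof.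
rewrite /windows size_cat iotaD map_cat; congr (_ ++ _).
rewrite add0n -[in iota (size u) _](addn0 (size u)) iotaDl -map_comp.
apply/eq_in_map => j; rewrite mem_iota => /andP[_ lt_j] /=.
by rewrite addnC rotD ?rot_size_cat // size_cat; lia.
Qed.

Lemma windows_rot k i c : perm_eq (windows k (rot i c)) (windows k c).
Proof.
rewrite -[in X in perm_eq _ X](cat_take_drop i c) {1}/rot !windows_cat.
by rewrite perm_catC.
Qed.

(** A window starting inside u reads at most k - 1 symbols beyond the end of u, and
    these are the same whether v or u itself comes next. *)
Lemma heads_cat k u v : k <= size u -> k <= size v -> take k.-1 u = take k.-1 v ->
  [seq take k (rot i (u ++ v)) | i <- iota 0 (size u)] = windows k u.
Proof.
move=> ku kv uv; apply/eq_in_map => i; rewrite mem_iota add0n => /andP[_ lt_i].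
rewrite /rot drop_cat (take_cat i) lt_i -catA.
rewrite [LHS]take_cat [RHS]take_cat size_drop.
case: ltnP => // le_k; congr (_ ++ _).
set j := k - _; have le_j : j <= k.-1 by lia.
have -> : take j (v ++ take i u) = take j v by rewrite takel_cat //; lia.
have le_ji : j <= i by rewrite /j; lia.
by rewrite [RHS]take_takel // -[LHS](take_takel v le_j) -uv take_takel.
Qed.

Lemma windows_splice k u v :
  k <= size u -> k <= size v -> take k.-1 u = take k.-1 v ->
  windows k (u ++ v) = windows k u ++ windows k v.
Proof. by move=> ku kv uv; rewrite windows_cat !heads_cat. Qed.

Definition overlap k c d := has (mem (windows k.-1 c)) (windows k.-1 d).

Lemma merge k c d : k <= size c -> k <= size d -> overlap k c d ->
  exists2 e, k <= size e & perm_eq (windows k e) (windows k c ++ windows k d).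
Proof.
move=> kc kd /hasP[g /windowsP[j _ gd]] /windowsP[i _ gc].
exists (rot i c ++ rot j d); first by rewrite size_cat !size_rot; lia.
rewrite windows_splice ?size_rot -?gc //.
by apply: perm_cat; apply: windows_rot.
Qed.

End Windows.

Lemma windows_map (T U : eqType) (f : T -> U) k c :
  windows k (map f c) = map (map f) (windows k c).
Proof.
rewrite /windows size_map -map_comp; apply: eq_map => i /=.
by rewrite -map_rot map_take.
Qed.

Lemma overlap_map (S T U : eqType) (f : S -> U) (g : T -> U) k c d w w' :
  w \in windows k.-1 c -> w' \in windows k.-1 d -> map f w = map g w' ->
  overlap k (map f c) (map g d).
Proof.
move=> wc wd e; apply/hasP; exists (map g w').
  by rewrite windows_map map_f.
by rewrite inE -e windows_map map_f.
Qed.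

Section Joined.
Variables (T : eqType) (I : eqType) (k : nat) (cycle_of : I -> seq T).

Definition joined (r : seq I) := exists2 c, k <= size c &
  perm_eq (windows k c) (flatten [seq windows k (cycle_of x) | x <- r]).

Lemma joined_perm r s : perm_eq r s -> joined r -> joined s.
Proof.
move=> rs [c kc wc]; exists c => //; apply: perm_trans wc _.
by apply/perm_flatten/perm_map.
Qed.

Lemma joined_rcons r x y : joined r -> k <= size (cycle_of y) ->
  x \in r -> overlap k (cycle_of x) (cycle_of y) -> joined (y :: r).
Proof.
move=> [c kc wc] ky xr /hasP[g gy gx].
have gc : g \in windows k.-1 c.
  move: gx; rewrite /= !(@windows_take _ k.-1 k) ?leq_pred // => /mapP[w wx ->].
  apply: map_f; rewrite (perm_mem wc); apply/flattenP.
  by exists (windows k (cycle_of x)) => //; apply: map_f.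
have yc : overlap k (cycle_of y) c by apply/hasP; exists g.
have [e ke we] := merge ky kc yc.
by exists e => //; apply: perm_trans we _; rewrite /= perm_cat2l.
Qed.

(** The rank orients the gluing: starting from the word of x0, a word of least rank
    among those not yet glued always overlaps one that is. *)
Lemma joined_rank (r : seq I) (rank : I -> nat) x0 : uniq r -> x0 \in r ->
  (forall x, x \in r -> k <= size (cycle_of x)) ->
  (forall x, x \in r -> x != x0 ->
     exists y, [/\ y \in r, rank y < rank x & overlap k (cycle_of y) (cycle_of x)]) ->
  joined r.
Proof.
move=> ur x0r kr step.
have [n] := ubnP (size r - 1).
have: joined [:: x0].
  have k0 := kr _ x0r.
  by exists (cycle_of x0); rewrite //= cats0.
have: {subset [:: x0] <= r} by move=> x; rewrite inE => /eqP->.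
have: x0 \in [:: x0] by rewrite inE.
have: uniq [:: x0] by [].
rewrite -[1]/(size [:: x0]).
elim: n [:: x0] => // n IHn s us x0s sr js lt_n.
have [rs | /allPn[x xr xs]] := boolP (all (mem s) r).
  apply: joined_perm js; apply: uniq_perm => // x.
  by apply/idP/idP => [/sr | /(allP rs)].
have exm : exists n, has (fun x => (x \notin s) && (rank x == n)) r.
  by exists (rank x); apply/hasP; exists x; rewrite ?xs /=.
case: (ex_minnP exm) => m /hasP[{xs}x {}xr /andP[xs /eqP xm]] min_m.
have x_x0 : x != x0 by apply: contraNneq xs => ->.
have [y [yr lt_yx yx]] := step x xr x_x0.
have ys : y \in s.
  apply/negPn/negP => ys; have: m <= rank y.
    by apply: min_m; apply/hasP; exists y; rewrite ?ys /=.
  by rewrite leqNgt -xm lt_yx.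
have sub : {subset x :: s <= r} by move=> z; rewrite inE => /predU1P[-> | /sr].
have uxs : uniq (x :: s) by rewrite /= xs.
apply: (IHn (x :: s)) => //; first by rewrite inE x0s orbT.
  exact: joined_rcons js (kr _ xr) ys yx.
by have := uniq_leq_size uxs sub; rewrite /=; lia.
Qed.

End Joined.

(** * Subsets as increasing sequences *)

(** Enumerates without duplication when s has none, and evaluates fast enough to
    decide statements about the 3060 quadruples of eighteen points. *)
Fixpoint ksubseqs (T : Type) k (s : seq T) : seq (seq T) :=
  match k, s with
  | 0, _ => [:: [::]]
  | _.+1, [::] => [::]
  | k'.+1, x :: s' => map (cons x) (ksubseqs k' s') ++ ksubseqs k s'
  end.

Lemma mem_ksubseqs (T : eqType) k (s t : seq T) :
  uniq s -> (t \in ksubseqs k s) = subseq t s && (size t == k).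
Proof.
elim: s k t => [|x s IHs] [|k] t; rewrite ?[ksubseqs _ _]/= ?inE ?size_eq0.
- by case: t.
- by case: t => // y t; rewrite andbF.
- by case: t => // y t; rewrite andbF.
rewrite -/(ksubseqs _ _) mem_cat => /andP[xs us]; rewrite !IHs //.
case: t => [|y t]; first by rewrite andbF orbF; apply/negP => /mapP[].
rewrite /= eqSS.
have -> : (y :: t \in map (cons x) (ksubseqs k s)) = (y == x) && (t \in ksubseqs k s).
  apply/mapP/andP => [[z zs [-> ->]] | [/eqP-> ts]]; first by rewrite eqxx.
  by exists t.
rewrite IHs //; case: (y =P x) => //= ->.
have [/= /mem_subseq sub | ] := boolP (subseq (x :: t) s); last by rewrite orbF.
by case/negP: xs; apply: sub; rewrite inE eqxx.
Qed.

Lemma ksubseqs_uniq (T : eqType) k (s : seq T) : uniq s -> uniq (ksubseqs k s).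
Proof.
elim: s k => [|x s IHs] [|k] //= /andP[xs us].
rewrite cat_uniq map_inj_uniq ?IHs // => [|y z [] //].
rewrite -/(ksubseqs _ _) andbT /=; apply/hasPn => t.
rewrite mem_ksubseqs // => /andP[ts _].
by apply/mapP => -[u _ Et]; case/negP: xs; apply: (mem_subseq ts); rewrite Et inE eqxx.
Qed.

Lemma sorted_ltn_subseq s1 s2 : sorted ltn s1 -> sorted ltn s2 ->
  {subset s1 <= s2} -> subseq s1 s2.
Proof.
move=> o1 o2 sub; have u2 : uniq s2.
  by apply: sorted_uniq o2; [exact: ltn_trans | exact: ltnn].
apply/subseq_uniqP => //; apply: (irr_sorted_eq ltn_trans ltnn) => //.
  exact: sorted_filter ltn_trans _ _ o2.
by move=> x; rewrite mem_filter; case: (boolP (x \in s1)) => // /sub->.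
Qed.

Lemma mem_ksubseqs_iota k n t : (t \in ksubseqs k (iota 0 n))
  = [&& sorted ltn t, all (gtn n) t & size t == k].
Proof.
rewrite mem_ksubseqs ?iota_uniq // andbA; congr (_ && _).
apply/idP/andP => [sub | [o /allP lt_n]].
  split; first by apply: subseq_sorted sub (iota_ltn_sorted _ _); exact: ltn_trans.
  by apply/allP => x /(mem_subseq sub); rewrite mem_iota.
apply: sorted_ltn_subseq o (iota_ltn_sorted _ _) _ => x /lt_n /=.
by rewrite mem_iota.
Qed.

Lemma subseq_val_enum n (S : {set 'I_n}) : subseq (map val (enum S)) (iota 0 n).
Proof. by rewrite -val_enum_ord map_subseq // enumT filter_subseq. Qed.

(** Sorting the underlying numbers is a canonical form for the set spanned by w. *)
Lemma sort_val_enum n (w : seq 'I_n) (S : {set 'I_n}) : uniq w ->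
  (S == [set:: w]) = (sort leq (map val w) == map val (enum S)).
Proof.
move=> uw; have oS : sorted ltn (map val (enum S)).
  exact: (subseq_sorted ltn_trans (subseq_val_enum S) (iota_ltn_sorted 0 n)).
have ow : sorted ltn (sort leq (map val w)).
  rewrite ltn_sorted_uniq_leq sort_uniq (map_inj_uniq val_inj) uw.
  by rewrite sort_sorted //; apply: leq_total.
apply/eqP/eqP => [ES | Es].
  apply: (irr_sorted_eq ltn_trans ltnn ow oS) => x; rewrite mem_sort.
  by apply: eq_mem_map => y; rewrite mem_enum ES inE.
apply/setP => y; rewrite inE -(mem_map val_inj w) -(mem_sort leq) Es.
by rewrite mem_map ?mem_enum //; apply: val_inj.
Qed.

Lemma nth_rot (T : Type) (x0 : T) c i j : i < size c -> j < size c ->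
  nth x0 (rot i c) j = nth x0 c ((i + j) %% size c).
Proof.
move=> lt_i lt_j; rewrite /rot nth_cat size_drop nth_drop.
case: ltnP => h; first by rewrite modn_small //; lia.
have -> : i + j = (i + j - size c) + size c by lia.
rewrite modnDr modn_small ?nth_take; [congr nth | ..]; lia.
Qed.

(** Bridge from closed words of natural numbers to universal cycles: with sorted
    windows as names for subsets, the equality of the two lists up to order says at
    once that every subset occurs and that none occurs twice. *)
Lemma universal_cycle_of_seq n k (c : seq nat) : 0 < k -> k <= size c ->
  perm_eq [seq sort leq w | w <- windows k c] (ksubseqs k (iota 0 n)) ->
  has_universal_cycle k [set: 'I_n].
Proof.
move=> k_gt0 le_kc keysE.
have key_in i : i < size c -> sort leq (take k (rot i c)) \in ksubseqs k (iota 0 n).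
  by move=> lt_i; rewrite -(perm_mem keysE) map_f //; apply/windowsP; exists i.
have lt_c i : i < size c -> nth 0 c i < n.
  move=> lt_i; have := key_in i lt_i; rewrite mem_ksubseqs_iota => /and3P[_ /allP lt_n _].
  have -> : nth 0 c i = nth 0 (take k (rot i c)) 0.
    by rewrite nth_take // nth_rot ?addn0 ?modn_small //; lia.
  by apply: lt_n; rewrite mem_sort mem_nth // size_takel // size_rot.
have sz_c : size c = (size c).-1.+1 by rewrite prednK //; lia.
set N := (size c).-1 in sz_c.
have lt_cN (x : nat) : nth 0 c (x %% N.+1) < n by rewrite lt_c // -sz_c ltn_mod; lia.
pose C : N.+1.-tuple 'I_n := [tuple Ordinal (lt_cN i) | i < N.+1].
have winE (x : 'I_N.+1) : map val (window C k x) = take k (rot x c).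
  apply: (@eq_from_nth _ 0).
    by rewrite size_map size_mkseq size_takel // size_rot.
  rewrite size_map size_mkseq => i lt_i.
  rewrite (nth_map (Ordinal (lt_cN 0))) ?size_mkseq // nth_mkseq //.
  rewrite nth_take // nth_rot ?sz_c // -?sz_c; last exact: leq_trans le_kc.
  by rewrite /cycle_symbol tnth_mktuple /= inordK ?ltn_mod // modn_mod.
have uwin (x : 'I_N.+1) : uniq (window C k x).
  rewrite -(map_inj_uniq val_inj) winE -(sort_uniq leq).
  have := key_in x; rewrite sz_c => /(_ (ltn_ord x)).
  by rewrite mem_ksubseqs_iota => /and3P[+ _ _]; rewrite ltn_sorted_uniq_leq => /andP[].
exists N, C; split=> [x | S _ cardS].
  by split=> // y _; rewrite inE.
have : map val (enum S) \in ksubseqs k (iota 0 n).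
  rewrite mem_ksubseqs ?iota_uniq // size_map -cardE cardS eqxx andbT.
  exact: subseq_val_enum.
rewrite -(perm_mem keysE) => /mapP[_ /windowsP[i lt_i ->] ES].
rewrite sz_c in lt_i; exists (Ordinal lt_i); split.
  by apply/eqP; rewrite sort_val_enum // winE ES.
move=> y /eqP; rewrite sort_val_enum // winE ES => /eqP Ey.
have nthE (j : 'I_N.+1) : nth [::] [seq sort leq w | w <- windows k c] j
    = sort leq (take k (rot j c)).
  rewrite (nth_map [::]) ?size_windows ?sz_c // (nth_map 0) ?size_iota ?sz_c //.
  by rewrite nth_iota ?sz_c.
apply/eqP; rewrite -val_eqE /=.
rewrite -(nth_uniq [::] (s := [seq sort leq w | w <- windows k c])).
- by rewrite (nthE y) (nthE (Ordinal lt_i)) Ey.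
- by rewrite size_map size_windows sz_c.
- by rewrite size_map size_windows sz_c.
by rewrite (perm_uniq keysE) ksubseqs_uniq ?iota_uniq.
Qed.

(** * Supports and relabelling of pairs *)

Definition supp (s : seq nat) : seq nat := undup (map half s).

Lemma supp_sorted s : sorted ltn s -> sorted ltn (supp s).
Proof.
move=> os; rewrite ltn_sorted_uniq_leq undup_uniq /=.
apply: subseq_sorted (undup_subseq _) _; first exact: leq_trans.
by apply: homo_sorted os => x y /= lt_xy; apply: half_leq; apply: ltnW.
Qed.

Lemma mem_supp s : supp s =i map half s.
Proof. by move=> x; rewrite mem_undup. Qed.

(** The map on points induced by the map i |-> ps_i on pairs: the two points of the
    pair i go to the two points of the pair ps_i, parities being kept. *)
Definition place (ps : seq nat) x := (nth 0 ps x./2).*2 + odd x.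

Lemma half_place ps x : (place ps x)./2 = nth 0 ps x./2.
Proof. by rewrite /place addnC half_bit_double. Qed.

Lemma nth_mono ps : sorted ltn ps ->
  {in gtn (size ps) &, {mono nth 0 ps : i j / i < j}}.
Proof.
move=> ops i j hi hj; have lt_nth := sorted_ltn_nth ltn_trans 0 ops.
case: (ltngtP i j) => [lt_ij | lt_ji | ->]; last by rewrite ltnn.
- exact: (lt_nth i j).
- by apply/negbTE; rewrite -leqNgt ltnW // (lt_nth j i).
Qed.

Lemma place_mono ps : sorted ltn ps ->
  {in gtn (size ps).*2 &, {mono place ps : x y / x < y}}.
Proof.
move=> ops x y; rewrite !inE => lt_x lt_y; rewrite /place.
have [hx hy] : x./2 < size ps /\ y./2 < size ps by lia.
have Ex := odd_double_half x; have Ey := odd_double_half y.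
have bx := leq_b1 (odd x); have b_y := leq_b1 (odd y).
case: (ltngtP x./2 y./2) => [lt_xy | lt_yx | eq_xy].
- by move: (lt_xy); rewrite -(nth_mono ops hx hy) => lt_n; apply/idP/idP; lia.
- by move: (lt_yx); rewrite -(nth_mono ops hy hx) => lt_n; apply/idP/idP; lia.
- by rewrite eq_xy; apply/idP/idP; lia.
Qed.

Lemma place_homo ps : sorted ltn ps ->
  {in gtn (size ps).*2 &, {homo place ps : x y / x <= y}}.
Proof.
move=> ops x y hx hy; rewrite leq_eqVlt => /predU1P[-> //|].
by rewrite -(place_mono ops) // => /ltnW.
Qed.

Lemma supp_place ps s : sorted ltn ps -> all (gtn (size ps).*2) s ->
  sorted ltn s -> supp (map (place ps) s) = map (nth 0 ps) (supp s).
Proof.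
move=> ops lt_s os; apply: (irr_sorted_eq ltn_trans ltnn).
- by apply: supp_sorted; rewrite (mono_sorted_in (place_mono ops)).
- rewrite (@mono_sorted_in _ _ (gtn (size ps)) _ ltn) ?supp_sorted //.
    exact: nth_mono ops.
  apply/allP => i; rewrite mem_supp => /mapP[x xs ->] /=.
  by have := allP lt_s _ xs; rewrite /=; lia.
move=> i; rewrite mem_supp -map_comp.
rewrite (eq_map (g := nth 0 ps \o half)); last by move=> x /=; rewrite half_place.
by rewrite map_comp; apply: eq_mem_map => j; rewrite mem_supp.
Qed.

Lemma sort_place ps w : sorted ltn ps -> all (gtn (size ps).*2) w ->
  sort leq (map (place ps) w) = map (place ps) (sort leq w).
Proof.
move=> ops; apply: homo_sort_map_in.
- move=> x y hx hy /= /andP[le1 le2].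
  by case: (ltngtP x y) => //; rewrite -(place_mono ops) // ltnNge ?le1 ?le2.
- by move=> y x z _ _ _ /=; apply: leq_trans.
- by move=> x y _ _; apply: leq_total.
- exact: place_homo.
Qed.

(** The image under place ps of a family of quadruples described by their supports
    is described by the same condition, read on positions in ps. *)
Lemma mem_map_place m ps (P : pred (seq nat)) t :
  sorted ltn ps -> all (gtn m) ps ->
  (t \in map (map (place ps))
      [seq s <- ksubseqs 4 (iota 0 (size ps).*2) | P (supp s)])
  = [&& t \in ksubseqs 4 (iota 0 m.*2), all (mem ps) (supp t)
      & P (map (index^~ ps) (supp t))].
Proof.
move=> ops lt_m.
have ups : uniq ps by apply: sorted_uniq ops; [exact: ltn_trans | exact: ltnn].
have suppE s : sorted ltn s -> all (gtn (size ps).*2) s ->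
    map (index^~ ps) (supp (map (place ps) s)) = supp s.
  move=> os lt_s; rewrite supp_place // -map_comp map_id_in // => i.
  rewrite mem_supp => /mapP[x xs ->] /=; apply: index_uniq => //.
  by have := allP lt_s _ xs; rewrite /=; lia.
apply/mapP/and3P => [[s] | [ht sub Pt]].
  rewrite mem_filter mem_ksubseqs_iota => /andP[Ps /and3P[os lt_s sz]] ->; split.
  - rewrite mem_ksubseqs_iota size_map sz (mono_sorted_in (place_mono ops)) // os andbT.
    apply/allP => y /mapP[x xs ->] /=.
    have hx : x./2 < size ps by have := allP lt_s _ xs; rewrite /=; lia.
    have /= hn := allP lt_m _ (mem_nth 0 hx).
    by rewrite /place; have := leq_b1 (odd x); lia.
  - rewrite supp_place //; apply/allP => y /mapP[i].
    rewrite mem_supp => /mapP[x xs ->] -> /=; apply: mem_nth.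
    by have := allP lt_s _ xs; rewrite /=; lia.
  - by rewrite suppE.
pose loc x := (index x./2 ps).*2 + odd x.
have half_in x : x \in t -> x./2 \in ps.
  by move=> xt; apply: (allP sub); rewrite mem_supp map_f.
have locK : map (place ps) (map loc t) = t.
  rewrite -map_comp map_id_in // => x xt /=.
  have half_loc : (loc x)./2 = index x./2 ps by rewrite /loc addnC half_bit_double.
  rewrite /place half_loc nth_index ?half_in // /loc oddD odd_double oddb.
  by rewrite addnC odd_double_half.
have lt_s : all (gtn (size ps).*2) (map loc t).
  apply/allP => y /mapP[x xt ->] /=.
  have := half_in x xt; rewrite -index_mem /loc.
  by move: (index _ _) (size ps) (odd x) => i N [] /=; lia.
move: (ht); rewrite mem_ksubseqs_iota => /and3P[ot _ sz].
have os : sorted ltn (map loc t).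
  by rewrite -(mono_sorted_in (place_mono ops)) // locK.
exists (map loc t); last by rewrite locK.
by rewrite mem_filter mem_ksubseqs_iota os lt_s size_map sz -(suppE _ os lt_s) locK Pt.
Qed.

(** * The four templates *)

(** A universal cycle on the 4-subsets of ten points. *)
Definition word10 : seq nat :=
  [:: 5; 1; 3; 0; 8; 5; 2; 9; 3; 7; 0; 2; 1; 8; 9; 0; 3; 5; 4; 9; 0; 7; 5;
      4; 3; 8; 7; 0; 6; 4; 9; 8; 0; 7; 2; 9; 5; 6; 8; 2; 3; 9; 1; 8; 6; 3;
      0; 7; 1; 5; 8; 0; 9; 6; 7; 8; 1; 3; 2; 7; 8; 5; 3; 2; 1; 6; 5; 8; 4;
      2; 7; 6; 8; 5; 0; 7; 3; 4; 6; 0; 1; 7; 9; 6; 4; 1; 8; 5; 9; 3; 6; 8;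
      7; 4; 5; 6; 9; 1; 0; 5; 6; 3; 1; 0; 9; 4; 3; 6; 2; 0; 5; 4; 6; 3; 8;
      5; 1; 2; 4; 8; 9; 5; 7; 4; 2; 9; 6; 3; 7; 1; 4; 6; 5; 2; 3; 4; 7; 9;
      8; 3; 4; 1; 9; 8; 7; 2; 1; 4; 0; 8; 3; 2; 4; 1; 6; 3; 9; 0; 2; 6; 7;
      3; 5; 2; 0; 7; 4; 1; 5; 9; 2; 4; 3; 0; 1; 2; 5; 7; 6; 1; 2; 9; 7; 6;
      5; 0; 9; 2; 8; 6; 0; 4; 2; 8; 6; 1; 0; 2; 9; 4; 1; 7; 8; 0; 4; 5; 1;
      3; 7; 9].

(** Pair 0, then two blocks, the pairs 1 to 4 and 5 to 8. The windows are the 16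
    unions of a pair of each block, and for each of these the 12 sets that meet
    both pairs and pair 0. The word begins with the alternating letters
    2, 10, 3, and also contains 4, 12, 5 and 6, 14, 7 and 8, 16, 9: through them
    the words on three pairs get attached. *)
Definition word18 : seq nat :=
  [:: 2; 10; 3; 1; 0; 15; 9; 8; 1; 13; 12; 7; 6; 1; 11; 10; 5; 4; 1; 17; 16;
      3; 2; 1; 15; 14; 9; 8; 1; 12; 0; 6; 7; 17; 1; 0; 8; 16; 9; 1; 0; 13;
      7; 6; 1; 10; 0; 4; 5; 15; 1; 0; 6; 14; 7; 1; 0; 11; 5; 4; 1; 16; 0; 2;
      3; 15; 14; 0; 2; 3; 12; 13; 0; 4; 5; 17; 16; 0; 4; 5; 14; 15; 0; 6; 7;
      11; 10; 0; 6; 7; 16; 17; 0; 8; 9; 13; 12; 0; 8; 9; 10; 11; 0; 2; 3;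
      13; 1; 0; 4; 12; 5; 1; 0; 17; 6; 16; 1; 0; 7; 15; 14; 1; 3; 0; 16; 17;
      2; 1; 0; 15; 4; 14; 1; 0; 5; 13; 12; 1; 9; 0; 14; 15; 8; 1; 0; 13; 2;
      12; 1; 0; 3; 11; 10; 1; 9; 8; 17; 16; 1; 7; 6; 15; 14; 1; 5; 4; 13;
      12; 1; 3; 2; 11; 10; 1; 7; 0; 12; 13; 6; 1; 0; 11; 8; 10; 1; 0; 9; 17;
      16; 1; 5; 0; 10; 11; 4; 1; 0; 17; 3; 2; 1; 14; 0; 8; 9; 11; 1; 0].

(** The hexagons a b a' c' b' c and a b' a' c b c', with (a,a') the first pair,
    (c,c') the second and (b,b') the third. The middle letter b or b' of an
    alternating window x b x' is in the largest pair in both words. *)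
Definition words6 := [:: [:: 0; 4; 1; 3; 5; 2]; [:: 0; 5; 1; 2; 4; 3]].

(** Two octagons of the 4-cube, each invariant under the antipodal map, in the cyclic
    order first, third, second, fourth of the pairs. This order makes each word share
    three consecutive letters with a word of words6 on the first, third and fourth
    pairs, and with one on the last three pairs. *)
Definition words8 := [:: [:: 0; 4; 3; 6; 1; 5; 2; 7]; [:: 0; 5; 3; 7; 1; 4; 2; 6]].

Definition template (ps : seq nat) :=
  match size ps with
  | 5 => [:: word10] | 9 => [:: word18] | 3 => words6 | 4 => words8 | _ => [::]
  end.

Definition off0 (q : seq nat) := filter (ltn 0) q.

(** The block of a pair i > 0; pair 0 belongs to no block, and i.-1 only gives it a
    harmless value. *)
Definition block i := i.-1 %/ 4.

(** One pair of each block, with or without pair 0. *)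
Definition owned9 (q : seq nat) :=
  [&& size (off0 q) == 2, head 0 (off0 q) < 5 & 4 < last 0 (off0 q)].

(** The supports, in local numbering, of the sets listed by a template. *)
Definition owned (ps : seq nat) : pred (seq nat) :=
  match size ps with
  | 5 => predT | 9 => owned9 | N => pred1 (iota 0 N)
  end.

Definition sorted_windows (cs : seq (seq nat)) :=
  [seq sort leq w | w <- flatten [seq windows 4 c | c <- cs]].

Definition owned_windows ps :=
  [seq s <- ksubseqs 4 (iota 0 (size ps).*2) | owned ps (supp s)].

(** The finite verification: 210, 208, 12 and 16 quadruples, each listed once. *)
Lemma template_windows ps : size ps \in [:: 3; 4; 5; 9] ->
  perm_eq (sorted_windows (template ps)) (owned_windows ps).
Proof.
rewrite /owned_windows /template /owned !inE.
by case/or4P => /eqP->; vm_compute.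
Qed.

Lemma template_bound ps :
  all (fun c => (3 < size c) && all (gtn (size ps).*2) c) (template ps).
Proof.
rewrite /template; move: (size ps) => N.
by do 10?[case: N => [|N]]; vm_compute.
Qed.

Lemma sorted_windows_place ps cs : sorted ltn ps ->
  all (fun c => all (gtn (size ps).*2) c) cs ->
  sorted_windows (map (map (place ps)) cs) = map (map (place ps)) (sorted_windows cs).
Proof.
move=> ops lt_cs; rewrite /sorted_windows -map_comp.
elim: cs lt_cs => //= c cs IHcs /andP[lt_c lt_cs].
rewrite !map_cat IHcs // windows_map -!map_comp; congr (_ ++ _).
apply: eq_map => i /=; apply: sort_place => //.
apply/allP => x /mem_take; rewrite mem_rot; exact: (allP lt_c).
Qed.

(** * Clusters partition the quadruples *)

Definition cluster5 a := 0 :: iota (4 * a).+1 4.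

Definition cluster9 a b := cluster5 a ++ iota (4 * b).+1 4.

(** In an increasing support, the extreme pairs other than pair 0 lie in the same
    block if and only if all do. *)
Definition owner (q : seq nat) :=
  let a := block (head 0 (off0 q)) in let b := block (last 0 (off0 q)) in
  if a == b then cluster5 a else if size (off0 q) == 2 then cluster9 a b else q.

Lemma blockE a x : 0 < x -> (block x == a) = (x \in iota (4 * a).+1 4).
Proof. by move=> x_gt0; rewrite mem_iota /block; apply/eqP/idP; lia. Qed.

Lemma block_leq x y : x <= y -> block x <= block y.
Proof. by move=> le_xy; rewrite /block leq_div2r //; lia. Qed.

Lemma off0_sorted q : sorted ltn q -> sorted ltn (off0 q).
Proof. exact: sorted_filter ltn_trans _ _. Qed.

Lemma off0_ends q x : sorted ltn q -> x \in off0 q ->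
  [/\ 0 < x, head 0 (off0 q) <= x & x <= last 0 (off0 q)].
Proof.
move=> /off0_sorted o xr; have x_gt0 : 0 < x by move: xr; rewrite mem_filter => /andP[].
have le_nth : {in gtn (size (off0 q)) &, {homo nth 0 (off0 q) : i j / i <= j}}.
  move: o; rewrite ltn_sorted_uniq_leq => /andP[_ o].
  exact: sorted_leq_nth leq_trans leqnn 0 _ o.
have lt_x : index x (off0 q) < size (off0 q) by rewrite index_mem.
have Ex : nth 0 (off0 q) (index x (off0 q)) = x by apply: nth_index.
split=> //; first by rewrite -nth0 -[x in _ <= x]Ex le_nth // inE; lia.
by rewrite -nth_last -[x in x <= _]Ex le_nth // ?inE; lia.
Qed.

Lemma size_off0 q : sorted ltn q -> size q <= (size (off0 q)).+1.
Proof.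
case: q => // x q o; have /allP gt_x := order_path_min ltn_trans o.
have Eq : off0 q = q.
  by apply/all_filterP/allP => y /gt_x /=; apply: leq_trans.
by rewrite /off0 /= -/(off0 q) Eq; case: ifP.
Qed.

Definition spread q := block (head 0 (off0 q)) != block (last 0 (off0 q)).

(** The sets of pairs that are owners. In the last case the condition says that
    three pairs never include pair 0: such supports belong to the case of two
    blocks. *)
Variant cluster m : seq nat -> Prop :=
| Cluster5 a of a < m : cluster m (cluster5 a)
| Cluster9 a b of a < b & b < m : cluster m (cluster9 a b)
| ClusterSpread q of sorted ltn q & all (gtn (4 * m).+1) q & size q \in [:: 3; 4]
    & spread q & (size q == 4) || (0 \notin q) : cluster m q.

(** Removing duplicates spares a proof that the three lists are disjoint. *)
Definition clusters m :=
  undup ([seq cluster5 a | a <- iota 0 m]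
    ++ [seq cluster9 a b | b <- iota 0 m, a <- iota 0 b]
    ++ [seq q <- ksubseqs 3 (iota 0 (4 * m).+1) ++ ksubseqs 4 (iota 0 (4 * m).+1)
         | spread q && ((size q == 4) || (0 \notin q))]).

Lemma clustersP m ps : reflect (cluster m ps) (ps \in clusters m).
Proof.
apply: (iffP idP) => [|].
  rewrite mem_undup !mem_cat => /or3P[/mapP[a] | /allpairsPdep[b [a []]] |].
  - by rewrite mem_iota => /andP[_ lt_a] ->; exact: Cluster5.
  - by rewrite !mem_iota => /andP[_ ?] /andP[_ ?] ->; exact: Cluster9.
  rewrite mem_filter mem_cat !mem_ksubseqs_iota => /andP[/andP[sp h]].
  case/orP => /and3P[o lt sz]; apply: ClusterSpread => //.
    by rewrite (eqP sz).
  by rewrite (eqP sz).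
case=> [a lt_a | a b lt_ab lt_b | q o lt sz sp h]; rewrite mem_undup !mem_cat.
- by rewrite map_f ?mem_iota.
- have -> : cluster9 a b \in [seq cluster9 a b | b <- iota 0 m, a <- iota 0 b].
    by apply/allpairsPdep; exists b, a; rewrite !mem_iota.
  by rewrite orbT.
apply/or3P/Or33; rewrite mem_filter sp h mem_cat !mem_ksubseqs_iota o lt /=.
by move: sz; rewrite !inE.
Qed.

Lemma cluster5_sorted a : sorted ltn (cluster5 a).
Proof. by rewrite /=; lia. Qed.

Lemma cluster9_sorted a b : a < b -> sorted ltn (cluster9 a b).
Proof. by move=> lt_ab; rewrite /=; lia. Qed.

Lemma cluster5_inj : injective cluster5.
Proof. by move=> a b /(congr1 (nth 0 ^~ 1)) /=; lia. Qed.

Lemma cluster9_inj a b c d : cluster9 a b = cluster9 c d -> a = c /\ b = d.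
Proof.
by move=> e; have /= := congr1 (nth 0 ^~ 1) e; have /= := congr1 (nth 0 ^~ 5) e; lia.
Qed.

Lemma cluster_wf m ps : cluster m ps ->
  [/\ sorted ltn ps, all (gtn (4 * m).+1) ps & size ps \in [:: 3; 4; 5; 9]].
Proof.
case=> [a lt_a | a b lt_ab lt_b | q o lt sz _ _]; split=> //.
- exact: cluster5_sorted.
- by rewrite /=; lia.
- exact: cluster9_sorted.
- by rewrite /=; lia.
- by move: sz; rewrite !inE => /orP[] ->; rewrite ?orbT.
Qed.

Lemma cluster3P m x j k : cluster m [:: x; j; k] <->
  [/\ 0 < x, x < j, j < k, k <= 4 * m & block x != block k].
Proof.
split=> [|[x0 lt_xj lt_jk le_k ne]].
  move Eps: [:: x; j; k] => ps hps; case: hps Eps => // q o lt _ sp h Eq.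
  move: o lt sp h; rewrite -Eq /spread /= !inE !andbT.
  move=> /andP[lt_xj lt_jk] /and3P[_ _ le_k] + h.
  have x0 : 0 < x by lia.
  by rewrite x0 (ltn_trans x0 lt_xj) (ltn_trans (ltn_trans x0 lt_xj) lt_jk).
have j0 : 0 < j by lia.
have k0 : 0 < k by lia.
apply: ClusterSpread;
  rewrite //= ?/spread /= ?x0 ?j0 ?k0 ?lt_xj ?lt_jk ?ltnS ?le_k //=; try lia.
by rewrite !inE; lia.
Qed.

Lemma cluster4P m h i j k : cluster m [:: h; i; j; k] <->
  [/\ h < i, i < j, j < k, k <= 4 * m
    & block (if 0 < h then h else i) != block k].
Proof.
split=> [|[lt_hi lt_ij lt_jk le_k ne]].
  move Eps: [:: h; i; j; k] => ps hps; case: hps Eps => // q o lt _ sp _ Eq.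
  move: o lt sp; rewrite -Eq /spread /= !andbT.
  move=> /and3P[lt_hi lt_ij lt_jk] /and4P[_ _ _ le_k].
  have [i0 j0 k0] : [/\ 0 < i, 0 < j & 0 < k] by split; lia.
  by rewrite i0 j0 k0; case: ifP.
have [i0 j0 k0] : [/\ 0 < i, 0 < j & 0 < k] by split; lia.
apply: ClusterSpread;
  rewrite //= ?/spread /= ?i0 ?j0 ?k0 ?lt_hi ?lt_ij ?lt_jk //=; try lia.
by case: ifP ne.
Qed.

Section Owner.
Variables (m : nat) (t : seq nat).
Hypothesis ht : t \in ksubseqs 4 (iota 0 (4 * m).+1.*2).
Let q : seq nat := supp t.

Lemma supp4 : [/\ sorted ltn q, all (gtn (4 * m).+1) q, size q <= 4
  & 0 < size (off0 q)].
Proof.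
move: ht; rewrite mem_ksubseqs_iota => /and3P[ot lt_t /eqP sz]; split.
- exact: supp_sorted.
- apply/allP => i; rewrite mem_supp => /mapP[x xt ->] /=.
  by have := allP lt_t _ xt; rewrite /=; lia.
- by apply: leq_trans (size_undup _) _; rewrite size_map sz.
rewrite size_filter -has_count; apply/hasP; exists (last 0 t)./2.
  rewrite mem_supp map_f //; case: (t) sz => // x s _; exact: mem_last.
case: (t) ot sz => [|x1 [|x2 [|x3 [|x4 []]]]] //=; lia.
Qed.

Lemma owner_cluster : cluster m (owner q).
Proof.
have [oq lt_q sz_q nz0] := supp4; rewrite /owner.
set a := block _; set b := block _.
have hd : head 0 (off0 q) \in off0 q by case: (off0 q) nz0 => //= x r _; rewrite inE eqxx.
have la : last 0 (off0 q) \in off0 q by case: (off0 q) nz0 => //= x r _; apply: mem_last.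
have [_ _ le_hl] := off0_ends oq hd.
have [l_gt0 _ _] := off0_ends oq la.
have le_ab : a <= b := block_leq le_hl.
have lt_b : b < m.
  have /= := allP lt_q _ (mem_subseq (filter_subseq _ _) la).
  by rewrite /b /block; move: (last 0 _) l_gt0 => l; lia.
case: eqP => [_ | /eqP ne_ab]; first by apply: Cluster5; exact: leq_ltn_trans lt_b.
case: ifP => [_ | sz2]; first by apply: Cluster9; rewrite // ltn_neqAle ne_ab.
have sz_nz : 2 < size (off0 q).
  move: nz0 sz2 ne_ab; rewrite /a /b.
  by case: (off0 q) => [|x [|y [|z r]]] //=; rewrite eqxx.
have sz_le : size (off0 q) <= size q by rewrite size_filter count_size.
apply: ClusterSpread => //; first by rewrite !inE; lia.
case: (ltngtP (size q) 4) => [lt4 | gt4 | //] /=; last by lia.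
apply/negP => q0; have : size (off0 q) < size q.
  rewrite size_filter -(count_predC (ltn 0) q) -[X in X < _]addn0 ltn_add2l -has_count.
  by apply/hasP; exists 0.
lia.
Qed.

(** The condition defining the template of ps, transported to ps, holds exactly for
    the supports whose owner is ps. With [mem_map_place] this shows both that
    every quadruple is listed by its owner and that no other cluster lists it. *)
Lemma owner_owned ps0 : cluster m ps0 ->
  all (mem ps0) q && owned ps0 (map (index^~ ps0) q) = (owner q == ps0).
Proof.
have [oq lt_q sz_q nz0] := supp4.
have hd : head 0 (off0 q) \in off0 q by case: (off0 q) nz0 => //= x r _; rewrite inE eqxx.
have la : last 0 (off0 q) \in off0 q by case: (off0 q) nz0 => //= x r _; apply: mem_last.
have nz_q x : x \in off0 q -> x \in q by rewrite mem_filter => /andP[].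
case=> [a lt_a | a b lt_ab lt_b | ps ops lt_ps sz sp h].
- rewrite andbT; apply/idP/idP => [/allP sub | /eqP].
    have blk_a x : x \in off0 q -> block x = a.
      move=> xr; have [x_gt0 _ _] := off0_ends oq xr; apply/eqP.
      by rewrite blockE //; move: (sub _ (nz_q _ xr)) x_gt0 => /predU1P[-> | ].
    by rewrite /owner !blk_a // eqxx.
  rewrite /owner; case: eqP => [e | _].
    move=> /cluster5_inj Ea.
    apply/allP => x xq; rewrite /= inE; case: (posnP x) => [-> // | x_gt0].
    have xr : x \in off0 q by rewrite mem_filter xq andbT.
    have [_ le_hx le_xl] := off0_ends oq xr.
    apply/orP; right; rewrite -[_ \in _]/(x \in iota (4 * a).+1 4) -blockE //.
    by rewrite eqn_leq -{2}Ea (block_leq le_hx) -{1}Ea e (block_leq le_xl).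
  by case: ifP => [//| _ Eq]; move: sz_q; rewrite Eq.
- set ps := cluster9 a b; set idx := index^~ ps.
  have idx_gt0 x : (0 < idx x) = (0 < x) by rewrite /idx /=; case: x.
  have idx_lt5 x : (idx x < 5) = (x \in cluster5 a).
    rewrite /idx /ps index_cat; case: ifP => [xU | _]; last by rewrite /=; lia.
    by rewrite -[5]/(size (cluster5 a)) index_mem.
  have nz_idx : off0 (map idx q) = map idx (off0 q).
    by rewrite /off0 filter_map; congr map; apply: eq_filter => x /=; rewrite idx_gt0.
  have -> : owned ps (map idx q) = [&& size (off0 q) == 2,
      head 0 (off0 q) \in cluster5 a & last 0 (off0 q) \notin cluster5 a].
    have hd_idx : head 0 (map idx (off0 q)) = idx (head 0 (off0 q)).
      by case: (off0 q) nz0.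
    have la_idx : last 0 (map idx (off0 q)) = idx (last 0 (off0 q)).
      exact: (last_map idx (off0 q) 0).
    rewrite -[owned ps]/owned9 /owned9 nz_idx size_map hd_idx la_idx.
    by rewrite -!idx_lt5 -leqNgt.
  have [hd_gt0 _ _] := off0_ends oq hd; have [la_gt0 _ _] := off0_ends oq la.
  have blk_U x c : 0 < x -> (x \in cluster5 c) = (block x == c).
    by move=> x_gt0; rewrite blockE // in_cons gtn_eqF.
  rewrite !blk_U //; apply/idP/eqP => [/and4P[/allP sub sz2 Ea Eb] | ].
    have Elb : block (last 0 (off0 q)) == b.
      have := sub _ (nz_q _ la); rewrite /= /ps mem_cat blk_U // (negPf Eb) /=.
      by rewrite blockE.
    by rewrite /owner (eqP Ea) (eqP Elb) sz2 ltn_eqF.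
  rewrite /owner; case: eqP => [_ | ne_ab]; first by move/(congr1 size).
  case: ifP => [sz2 /cluster9_inj[Ea Eb] | _ Eq]; last by move: sz_q; rewrite Eq.
  rewrite Ea eqxx Eb gtn_eqF // !andbT; apply/allP => x xq /=.
  case: (posnP x) => [-> // | x_gt0].
  have xr : x \in off0 q by rewrite mem_filter xq andbT.
  rewrite /ps mem_cat blk_U // -blockE //.
  move: sz2 Ea Eb xr; case: (off0 q) => [|y [|z []]] //= _ <- <-.
  by rewrite !inE => /orP[] /eqP->; rewrite eqxx ?orbT.
have -> : owned ps = pred1 (iota 0 (size ps)).
  by move: sz; rewrite /owned !inE => /orP[] /eqP->.
have own_ps : owner ps = ps.
  move: sp; rewrite /owner /spread => /negbTE->; case: ifP => // /eqP sz2.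
  have := size_off0 ops; move: sz h; rewrite sz2 !inE => /orP[] /eqP sz; rewrite sz //= => h.
  suff Eps : off0 ps = ps by move: sz2; rewrite Eps sz.
  by apply/all_filterP/allP => x xps /=; rewrite lt0n; apply: contraNneq h => <-.
apply/andP/eqP => [[/allP sub /= /eqP Eq] | ].
  suff -> : q = ps by [].
  rewrite -[q]map_id -[RHS](mkseq_nth 0) /mkseq -Eq -map_comp.
  by apply/eq_in_map => x xq /=; rewrite nth_index //; apply: sub.
rewrite /owner; case: eqP => _.
  by move=> e; move: sz; rewrite -e.
case: ifP => _; first by move=> e; move: sz; rewrite -e.
move=> ->; split; first by apply/allP.
rewrite /= -[X in map _ X](mkseq_nth 0) /mkseq -map_comp.
apply/eqP/map_id_in => i; rewrite mem_iota /= => lt_i; apply: index_uniq => //.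
by apply: sorted_uniq ops; [exact: ltn_trans | exact: ltnn].
Qed.

End Owner.

Lemma map_inj_in_all (T U : eqType) (P : {pred T}) (f : T -> U) :
  {in P &, injective f} -> {in all P &, injective (map f)}.
Proof.
move=> inj_f; elim=> [|x s IHs] [|y t] //= /andP[Px Ps] /andP[Py Pt] [/inj_f -> //].
by move/IHs => -> //.
Qed.

Lemma uniq_flatten_key (I T : eqType) (g : I -> seq T) (key : T -> I) r :
  uniq r -> (forall x, x \in r -> uniq (g x)) ->
  (forall x t, x \in r -> t \in g x -> key t = x) -> uniq (flatten (map g r)).
Proof.
elim: r => //= x r IHr /andP[xr ur] ug kg; rewrite cat_uniq ug ?inE ?eqxx //=.
apply/andP; split; last first.
  by apply: IHr => // y => [yr|t yr]; [apply: ug | apply: kg]; rewrite inE yr orbT.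
apply/hasPn => t /flattenP[_ /mapP[y yr ->] ty]; apply/negP => tx.
by move: xr; rewrite -(kg x t) ?inE ?eqxx // (kg y t) ?yr // inE yr orbT.
Qed.

Lemma sorted_windows_flatten (I : Type) (g : I -> seq (seq nat)) r :
  sorted_windows (flatten (map g r)) = flatten [seq sorted_windows (g x) | x <- r].
Proof.
by elim: r => //= x r <-; rewrite /sorted_windows map_cat flatten_cat map_cat.
Qed.

Lemma cluster_windows m ps : cluster m ps ->
  perm_eq (sorted_windows (map (map (place ps)) (template ps)))
          [seq t <- ksubseqs 4 (iota 0 (4 * m).+1.*2) | owner (supp t) == ps].
Proof.
move=> hps; have [ops lt_ps sz] := cluster_wf hps.
have in_bd := template_bound ps.
rewrite sorted_windows_place //; last by apply: sub_all in_bd => c /andP[].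
rewrite (perm_trans (perm_map _ (template_windows sz))) //.
apply: uniq_perm => [||t].
- rewrite map_inj_in_uniq ?filter_uniq ?ksubseqs_uniq ?iota_uniq //.
  move=> s s'; rewrite !mem_filter !mem_ksubseqs_iota.
  move=> /andP[_ /and3P[_ lt_s _]] /andP[_ /and3P[_ lt_s' _]].
  apply: (map_inj_in_all (P := gtn (size ps).*2)) => // x y hx hy e.
  by case: (ltngtP x y) => //; rewrite -(place_mono ops) // e ltnn.
- by rewrite filter_uniq ?ksubseqs_uniq ?iota_uniq.
rewrite (mem_map_place _ _ ops lt_ps) mem_filter andbC.
case: (boolP (t \in _)) => [ht | _]; last by rewrite !andbF.
by rewrite !andbT (owner_owned ht hps).
Qed.

(** A template has one or two words; a placement is a cluster with the index of a
    word in its template. *)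
Definition placements m :=
  [seq (ps, i) | ps <- clusters m, i <- iota 0 (size (template ps))].

Definition cycle_of (it : seq nat * nat) :=
  map (place it.1) (nth [::] (template it.1) it.2).

Lemma placements_uniq m : uniq (placements m).
Proof.
apply: allpairs_uniq_dep; first exact: undup_uniq.
  by move=> ps _; apply: iota_uniq.
by move=> [ps i] [qs j] _ _ /= [-> ->].
Qed.

Lemma mem_placements m ps i :
  ((ps, i) \in placements m) = (ps \in clusters m) && (i < size (template ps)).
Proof.
apply/allpairsPdep/andP => [[qs [j [h lt_j [-> ->]]]] | [h lt_i]].
  by rewrite mem_iota in lt_j.
by exists ps, i; rewrite mem_iota.
Qed.

Lemma placements_cycles m : map cycle_of (placements m)
  = flatten [seq map (map (place ps)) (template ps) | ps <- clusters m].
Proof.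
rewrite /placements map_flatten -map_comp; congr flatten; apply: eq_map => ps /=.
rewrite -map_comp -[in RHS](mkseq_nth [::] (template ps)) /mkseq -map_comp.
exact: eq_map.
Qed.

Lemma all_windows m :
  perm_eq (sorted_windows (map cycle_of (placements m)))
          (ksubseqs 4 (iota 0 (4 * m).+1.*2)).
Proof.
rewrite placements_cycles sorted_windows_flatten.
apply: uniq_perm => [||t].
- apply: (uniq_flatten_key (key := owner \o supp))
    => [|ps /clustersP h|ps t /clustersP h].
  + exact: undup_uniq.
  + by rewrite (perm_uniq (cluster_windows h)) filter_uniq ?ksubseqs_uniq ?iota_uniq.
  by rewrite (perm_mem (cluster_windows h)) mem_filter => /andP[/eqP].
- by rewrite ksubseqs_uniq ?iota_uniq.
apply/flattenP/idP => [[_ /mapP[ps /clustersP h ->]] | ht].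
  by rewrite (perm_mem (cluster_windows h)) mem_filter => /andP[].
have h := owner_cluster ht; set ps := owner _ in h.
exists (sorted_windows (map (map (place ps)) (template ps))).
  by apply: map_f; apply/clustersP.
by rewrite (perm_mem (cluster_windows h)) mem_filter eqxx.
Qed.

(** * Connectedness *)

(** The pair of block 0 at the position that k has in its own block. *)
Definition partner k := (k.-1 %% 4).+1.

(** The word of each placement overlaps one of smaller rank, as follows. Pair 0 with
    block 0 is the root (0). Pair 0 with blocks 0 and b attaches to it (1), pair 0
    with block b attaches to that (2), and pair 0 with blocks a and b to pair 0 with
    block a (3). First words on three pairs: (partner k, k-1, k) attaches to blocks
    0 and block k (4), (x, k-1, k) to it by a window on the pairs k-1 and k (5), and
    (x, j, k) to (x, k-1, k) by a window on x and k (6). First words on four pairs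
    without pair 0 attach to first words on three pairs (7). Second words on three
    pairs: (x, j, k) attaches to the first word on (1, x, j, k) when x > 1 (8),
    (1, j, k) to (2, j, k) when j > 2 (9), and (1, 2, k) to (1, 3, k) (10). All
    words on three pairs being reached, so are the other words on four pairs
    (11). *)
Definition rank (it : seq nat * nat) :=
  let: (ps, i) := it in
  let x := nth 0 ps 0 in let j := nth 0 ps 1 in let k := nth 0 ps 2 in
  match size ps with
  | 5 => if j == 1 then 0 else 2
  | 9 => if j == 1 then 1 else 3
  | 3 => if i == 0
         then if j != k.-1 then 6 else if x == partner k then 4 else 5
         else if 1 < x then 8 else if 2 < j then 9 else 10
  | _ => if (0 < x) && (i == 0) then 7 else 11
  end.

Lemma overlap_place ps qs c d w w' : w \in windows 3 c -> w' \in windows 3 d ->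
  map (place ps) w = map (place qs) w' -> overlap 4 (map (place ps) c) (map (place qs) d).
Proof. exact: (@overlap_map _ _ _ _ _ 4). Qed.

Lemma placements_joined m : 0 < m -> joined 4 cycle_of (placements m).
Proof.
move=> m_gt0.
apply: (@joined_rank _ _ _ _ _ rank (cluster5 0, 0)).
- exact: placements_uniq.
- by rewrite mem_placements; apply/andP; split=> //; apply/clustersP/Cluster5.
- move=> [ps i]; rewrite mem_placements => /andP[_ lt_i]; rewrite size_map.
  by have /andP[] := allP (template_bound ps) _ (mem_nth [::] lt_i).
move=> [ps i]; rewrite mem_placements => /andP[/clustersP hps].
case: hps => [a lt_a | a b lt_ab lt_b | q o lt sz sp h] lt_i ne0.
- have Ei : i = 0 by move: lt_i; case: i {ne0}.
  have a_gt0 : 0 < a.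
    by rewrite lt0n; apply: contraNneq ne0 => ->; rewrite Ei.
  (* letters 1, 3, 2 of word10, placed on the second block *)
  exists (cluster9 0 a, 0); split.
  + by rewrite mem_placements; apply/andP; split=> //; apply/clustersP/Cluster9.
  + by rewrite Ei; case: a a_gt0 {lt_a lt_i ne0}.
  by rewrite Ei; apply: (@overlap_place _ _ _ _ [:: 1; 11; 10] [:: 1; 3; 2]).
- have Ei : i = 0 by move: lt_i; case: i {ne0}.
  exists (cluster5 a, 0); split.
  + by rewrite mem_placements; apply/andP; split=> //; apply/clustersP/Cluster5; lia.
  + by rewrite Ei; case: a lt_ab {lt_i ne0}.
  by rewrite Ei; apply: (@overlap_place _ _ _ _ [:: 1; 3; 2] [:: 1; 3; 2]).
have {}hps : cluster m q by apply: ClusterSpread.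
have placementI qs c : cluster m qs -> c < size (template qs) -> (qs, c) \in placements m.
  by move=> hp hc; rewrite mem_placements hc andbT; apply/clustersP.
case: q {o lt sp h} sz lt_i ne0 hps => [|x [|j [|k [|l []]]]] // _ lt_i _.
  case/cluster3P=> x0 lt_xj lt_jk le_k ne.
  case: i lt_i => [|[|//]] _.
    (* keeping x and k, the middle pair can be moved next to k *)
    have [Ej | ne_j] := eqVneq j k.-1; last first.
      exists ([:: x; k.-1; k], 0); split.
      + by apply: placementI => //; apply/cluster3P; split=> //; lia.
      + by rewrite /rank /= ne_j eqxx /=; case: ifP.
      by apply: (@overlap_place _ _ _ _ [:: 0; 4; 1] [:: 0; 4; 1]).
    have k_gt4 : 4 < k by move: ne; rewrite /block; lia.
    (* the pair k and its partner sit at equal positions of two blocks, where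
       word18 contains the consecutive letters 2r, 2(r+4), 2r+1 *)
    have [Ex | ne_x] := eqVneq x (partner k).
      exists (cluster9 0 (block k), 0); split.
      + by apply: placementI => //; apply: Cluster9; move: ne; rewrite /block; lia.
      + by rewrite /rank /= Ej Ex !eqxx.
      have Ek : k = ((4 * block k).+1 + k.-1 %% 4) by rewrite /block; lia.
      rewrite Ex /partner; have : k.-1 %% 4 < 4 by rewrite ltn_mod.
      move: (k.-1 %% 4) (block k) Ek => r b -> {Ej}; case: r => [|[|[|[|//]]]] _.
      + apply: (@overlap_place _ _ _ _ [:: 2; 10; 3] [:: 0; 4; 1]) => //.
        by rewrite /place /=; congr [:: _; _; _]; lia.
      + apply: (@overlap_place _ _ _ _ [:: 4; 12; 5] [:: 0; 4; 1]) => //.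
        by rewrite /place /=; congr [:: _; _; _]; lia.
      + apply: (@overlap_place _ _ _ _ [:: 6; 14; 7] [:: 0; 4; 1]) => //.
        by rewrite /place /=; congr [:: _; _; _]; lia.
      + apply: (@overlap_place _ _ _ _ [:: 8; 16; 9] [:: 0; 4; 1]) => //.
        by rewrite /place /=; congr [:: _; _; _]; lia.
    exists ([:: partner k; k.-1; k], 0); split.
    + apply: placementI => //; apply/cluster3P.
      by move: ne; rewrite /partner /block => ne'; split; lia.
    + by rewrite /rank /= Ej !eqxx (negPf ne_x).
    by rewrite Ej; apply: (@overlap_place _ _ _ _ [:: 3; 5; 2] [:: 3; 5; 2]).
  (* the second word on three pairs, reached from an eight-letter word *)
  have [x_gt1 | x_le1] := ltnP 1 x.
    exists ([:: 1; x; j; k], 0); split.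
    + apply: placementI => //; apply/cluster4P; split=> //=.
      by move: ne; rewrite /block; lia.
    + by rewrite /rank /= x_gt1.
    by apply: (@overlap_place _ _ _ _ [:: 5; 2; 7] [:: 3; 0; 5]).
  (* no pair of a block precedes pair 1, so an alternating window links two
     second words instead *)
  have Ex : x = 1 by lia.
  have [j_gt2 | j_le2] := ltnP 2 j.
    exists ([:: 2; j; k], 1); split.
    + apply: placementI => //; apply/cluster3P.
      by move: ne; rewrite Ex /block => ne'; split; lia.
    + by rewrite /rank Ex /= j_gt2.
    by apply: (@overlap_place _ _ _ _ [:: 2; 4; 3] [:: 2; 4; 3]).
  exists ([:: 1; 3; k], 1); split.
  + apply: placementI => //; apply/cluster3P.
    by move: ne; rewrite Ex /block => ne'; split; lia.
  + by rewrite /rank /= Ex /= [2 < j]ltnNge j_le2.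
  by rewrite Ex; apply: (@overlap_place _ _ _ _ [:: 0; 5; 1] [:: 0; 5; 1]).
case/cluster4P=> lt_xj lt_jk lt_kl le_l.
(* four pairs: the last three form a cluster when the first is pair 0, and the
   first, third and fourth do otherwise *)
case: i lt_i => [|[|//]] _; case: (posnP x) => [-> /= | x_gt0] ne.
- exists ([:: j; k; l], 1); split.
  + by apply: placementI => //; apply/cluster3P; split=> //; lia.
  + by rewrite /rank /=; do 2?case: ifP.
  by apply: (@overlap_place _ _ _ _ [:: 3; 0; 5] [:: 5; 2; 7]).
- exists ([:: x; k; l], 0); split.
  + by apply: placementI => //; apply/cluster3P; split=> //; lia.
  + by rewrite /rank /= x_gt0; do 2?case: ifP.
  by apply: (@overlap_place _ _ _ _ [:: 4; 1; 3] [:: 6; 1; 5]).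
- exists ([:: j; k; l], 0); split.
  + by apply: placementI => //; apply/cluster3P; split=> //; lia.
  + by rewrite /rank /=; do 2?case: ifP.
  by apply: (@overlap_place _ _ _ _ [:: 2; 0; 4] [:: 4; 2; 6]).
- exists ([:: x; k; l], 1); split.
  + by apply: placementI => //; apply/cluster3P; split=> //; lia.
  + by rewrite /rank /= andbF; do 2?case: ifP.
  by apply: (@overlap_place _ _ _ _ [:: 5; 1; 2] [:: 7; 1; 4]).
Qed.

(** * Universal cycles *)

Lemma has_universal_cycle4 m : 0 < m -> has_universal_cycle 4 [set: 'I_(8 * m + 2)].
Proof.
move=> m_gt0; have [c le_c wc] := placements_joined m_gt0.
have -> : 8 * m + 2 = (4 * m).+1.*2 by lia.
apply: (@universal_cycle_of_seq _ 4 c) => //.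
apply: perm_trans (all_windows m).
rewrite /sorted_windows -(map_comp (windows 4) cycle_of).
exact: perm_map.
Qed.

Theorem mainTheorem2
  (h18 : has_universal_cycle 4 [set: 'I_18])
  (h26 : has_universal_cycle 4 [set: 'I_26]) :
  forall n : nat, 18 <= n -> n = 2 %[mod 8] ->
    has_universal_cycle 4 [set: 'I_n].
Proof.
move=> n le_n En; have -> : n = 8 * (n %/ 8) + 2 by lia.
by apply: has_universal_cycle4; lia.
Qed.
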